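(* Let $\lambda=m^{n_m}(m-1)^{n_{m-1}}\cdots 1^{n_1}$ be a rigid partition in the $B_n$, $C_n$ or $D_n$ theory, let $l$ be its length including the extra $0$ appended (if any) for the computation of the symbol, let $L(k)=\sum_{i=k}^{m}n_i$ be the length of the $k$-th row, and let $\alpha_1,\dots,\alpha_\mu$ (top row) and $\beta_1,\dots,\beta_\nu$ (bottom row) be all the entries of the symbol of $\lambda$. (1) Suppose that rows $k$ and $k+1$ are the two rows of a pairwise pattern and that $L(k)$ is even. Then the contribution to the symbol of the parts $m^{n_m}(m-1)^{n_{m-1}}\cdots k^{n_k}$ (i.e. $\lambda_1,\dots,\lambda_{L(k)}$) consists of exactly the entries $\alpha_{\mu-\frac12L(k)+1},\dots,\alpha_\mu$ of the top row and $\beta_{\nu-\frac12L(k)+1},\dots,\beta_\nu$ of the bottom row (all other positions being $0$). (2) Suppose that rows $k-1$ and $k$ are the two rows of a pairwise pattern ($k$ being the second row of the pair) and that $L(k)$ is odd. (2a) If $l-L(k)+\lambda_{L(k)}$ is odd, then the contribution of the parts $m^{n_m}\cdots k^{n_k}$ consists of exactly $\alpha_{\mu-\frac{L(k)-1}{2}},\dots,\alpha_\mu$ and $\beta_{\nu-\frac{L(k)-1}{2}+1},\dots,\beta_\nu$, and the contribution of the parts $m^{n_m}\cdots(k-1)^{n_{k-1}}$ consists of exactly $\alpha_{\mu-\frac{L(k-1)-1}{2}},\dots,\alpha_\mu$ and $\beta_{\nu-\frac{L(k-1)-1}{2}+1},\dots,\beta_\nu$. (2b) If $l-L(k)+\lambda_{L(k)}$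 is even, then the contribution of the parts $m^{n_m}\cdots k^{n_k}$ consists of exactly $\alpha_{\mu-\frac{L(k)-1}{2}+1},\dots,\alpha_\mu$ and $\beta_{\nu-\frac{L(k)-1}{2}},\dots,\beta_\nu$, and the contribution of the parts $m^{n_m}\cdots(k-1)^{n_{k-1}}$ consists of exactly $\alpha_{\mu-\frac{L(k-1)-1}{2}+1},\dots,\alpha_\mu$ and $\beta_{\nu-\frac{L(k-1)-1}{2}},\dots,\beta_\nu$.
   Context: Partitions are written $\lambda_1\ge\lambda_2\ge\cdots$, and $\lambda=m^{n_m}\cdots1^{n_1}$ means that the part $i$ occurs $n_i$ times. A $B_n$ (resp. $D_n$) partition is a partition of $2n+1$ (resp. $2n$) in which every even integer appears an even number of times; a $C_n$ partition is a partition of $2n$ in which every odd integer appears an even number of times. A partition is rigid if it has no gaps ($\lambda_i-\lambda_{i+1}\le 1$ for all $i$, with the smallest part equal to $1$, so $n_i\ge1$ for $1\le i\le m$) and no odd integer (for $B_n,D_n$), resp. no even integer (for $C_n$), appears exactly twice. Rows: the Young diagram is drawn so that the parts are columns; the $k$-th row ($1\le k\le m$) has length $L(k)=\#\{i:\lambda_i\ge k\}=\sum_{i=k}^m n_i$. The rows are grouped in pairs (''pairwise patterns''), the two rows in a pair having lengths of the same parity: for $B_n$ and $D_n$ the pairs are rows $(2,3),(4,5),\dots$; for $C_n$ they are rows $(1,2),(3,4),\dots$. Symbol: for $B_n$, nothing is appended; for $C_n$, if the length of the partition is odd, append one extra $0$ as last part; for $D_n$, always append one extra $0$ as last part. Let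 $l$ be the resulting number of parts (including an appended $0$). Form the numbers $l-k+\lambda_k$, $k=1,\dots,l$. Arrange the odd ones in increasing order as $2f_1+1<2f_2+1<\cdots$ and the even ones in increasing order as $2g_1<2g_2<\cdots$. Put $\alpha_i=f_i-i+1$ and $\beta_i=g_i-i+1$. The symbol is the two-row array with top row $\alpha_1,\alpha_2,\dots$ and bottom row $\beta_1,\beta_2,\dots$. The entry corresponding to the part $\lambda_k$ is the $\alpha_i$ with $2f_i+1=l-k+\lambda_k$ if this number is odd, or the $\beta_i$ with $2g_i=l-k+\lambda_k$ if it is even. The contribution to the symbol of a collection of parts is the array obtained from the symbol by keeping the entries corresponding to those parts and replacing all other entries by $0$. *)

(* Defs.v *)
From mathcomp Require Import all_boot.
Set Implicit Arguments.
Unset Strict Implicit.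
Unset Printing Implicit Defensive.

(* Parts, rows and symbol entries are all numbered from 1; the part of number
   [k] of a sequence [s] is therefore [nth 0 s k.-1]. *)

Inductive theory := TypeB | TypeC | TypeD.

Definition is_partition (lam : seq nat) : Prop :=
  sorted geq lam /\ 0 \notin lam.

Definition multiplicity (lam : seq nat) (i : nat) : nat := count_mem i lam.

Definition theory_partition (X : theory) (n : nat) (lam : seq nat) : Prop :=
  is_partition lam /\
  match X with
  | TypeB => sumn lam = n.*2.+1 /\ forall i, ~~ odd i -> ~~ odd (multiplicity lam i)
  | TypeC => sumn lam = n.*2 /\ forall i, odd i -> ~~ odd (multiplicity lam i)
  | TypeD => sumn lam = n.*2 /\ forall i, ~~ odd i -> ~~ odd (multiplicity lam i)
  end.

(* [nth] returns 0 beyond the last part, so the last instance of this condition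
   says that the smallest part is at most 1. *)
Definition no_gaps (lam : seq nat) : Prop :=
  forall i, nth 0 lam i - nth 0 lam i.+1 <= 1.

Definition rigid (X : theory) (lam : seq nat) : Prop :=
  no_gaps lam /\
  match X with
  | TypeB | TypeD => forall i, odd i -> multiplicity lam i != 2
  | TypeC => forall i, ~~ odd i -> multiplicity lam i != 2
  end.

Definition max_part (lam : seq nat) : nat := head 0 lam.

Definition row_len (lam : seq nat) (k : nat) : nat :=
  \sum_(k <= i < (max_part lam).+1) multiplicity lam i.

Definition row_pair (X : theory) (lam : seq nat) (r s : nat) : Prop :=
  [/\ 0 < r, s = r.+1, s <= max_part lam
    & match X with
      | TypeB | TypeD => ~~ odd r
      | TypeC => odd r
      end].

Definition extended (X : theory) (lam : seq nat) : seq nat :=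
  match X with
  | TypeB => lam
  | TypeC => if odd (size lam) then rcons lam 0 else lam
  | TypeD => rcons lam 0
  end.

Definition ext_len (X : theory) (lam : seq nat) : nat := size (extended X lam).

(* l - k + lambda_k, for 1 <= k <= l *)
Definition shifted (X : theory) (lam : seq nat) (k : nat) : nat :=
  ext_len X lam - k + nth 0 (extended X lam) k.-1.

(* In what follows the boolean [b] selects a row of the symbol by the parity of
   the numbers it is built from: [true] (odd numbers 2 f_i + 1) is the top row,
   [false] (even numbers 2 g_i) is the bottom row. *)

(* f_1 < f_2 < ... for [b = true], g_1 < g_2 < ... for [b = false] *)
Definition halves (X : theory) (lam : seq nat) (b : bool) : seq nat :=
  sort leq [seq v./2 | v <- [seq shifted X lam k | k <- iota 1 (ext_len X lam)]
                     & odd v == b].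

Definition nth_half (X : theory) (lam : seq nat) (b : bool) (i : nat) : nat :=
  nth 0 (halves X lam b) i.-1.

(* mu for [b = true], nu for [b = false] *)
Definition nentries (X : theory) (lam : seq nat) (b : bool) : nat :=
  size (halves X lam b).

(* f_i - i + 1, resp. g_i - i + 1. The subtraction does not truncate: the i-th
   term of a strictly increasing sequence of naturals is at least i - 1. *)
Definition entry (X : theory) (lam : seq nat) (b : bool) (i : nat) : nat :=
  nth_half X lam b i + 1 - i.

(* The entry of number [i] in row [b] corresponds to the part of number [k]. *)
Definition corresponds (X : theory) (lam : seq nat) (b : bool) (i k : nat) :
    bool :=
  shifted X lam k == (nth_half X lam b i).*2 + b.

(* The entry of number [i] in row [b] corresponds to a part whose number is
   in [S]. *)
Definition kept (X : theory) (lam : seq nat) (S : pred nat) (b : bool)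
    (i : nat) : bool :=
  has (fun k => S k && corresponds X lam b i k) (iota 1 (ext_len X lam)).

(* A row of the symbol in which the entries outside [P] are replaced by 0. *)
Definition masked_row (X : theory) (lam : seq nat) (b : bool) (P : pred nat) :
    seq nat :=
  [seq (if P i then entry X lam b i else 0) | i <- iota 1 (nentries X lam b)].

Definition contribution (X : theory) (lam : seq nat) (S : pred nat) :
    seq nat * seq nat :=
  (masked_row X lam true (kept X lam S true),
   masked_row X lam false (kept X lam S false)).

(* lambda_1, ..., lambda_{L(k)}, i.e. the parts m^{n_m} ... k^{n_k} *)
Definition parts_from (lam : seq nat) (k : nat) : pred nat :=
  fun j => 1 <= j <= row_len lam k.

(* The positions N - p + 1, ..., N among 1, ..., N *)
Definition last_positions (N p : nat) : pred nat :=
  fun i => N - p + 1 <= i <= N.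

(* The contribution of [S] consists of exactly the last [p] entries of the top
   row and the last [q] entries of the bottom row. Positions are compared as
   well as arrays, since an entry of the symbol may itself be equal to 0. *)
Definition contribution_consists_of (X : theory) (lam : seq nat)
    (S : pred nat) (p q : nat) : Prop :=
  let mu := nentries X lam true in
  let nu := nentries X lam false in
  [/\ p <= mu /\ q <= nu,
      forall i, 1 <= i <= mu -> kept X lam S true i = last_positions mu p i,
      forall i, 1 <= i <= nu -> kept X lam S false i = last_positions nu q i
    & contribution X lam S = (masked_row X lam true (last_positions mu p),
                              masked_row X lam false (last_positions nu q))].

(* Main.v *)
Require Import Defs.
From mathcomp Require Import all_boot.
From mathcomp Require Import zify.

(** The numbers [l - k + lambda_k] strictly decrease with [k], so the entries of
    the first [N] parts always fill the right ends of both rows of the symbol: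
    the last [p] places of the top row and the last [N - p] places of the bottom
    row, where [p] counts the odd numbers among the first [N]
    ([initial_parts_contribution]). It remains to find [p] when [N = L(k)].

    In all three theories the parts whose parity differs from that of [l] have
    even multiplicity ([even_multiplicity]): [l] is odd for types B and D and
    even for type C. A part of the same parity as [l] in position [j] has number
    congruent to [j] modulo 2; a part of the other parity has number congruent
    to [j + 1], but these parts form runs of even length, in which odd and even
    positions are equally many. As [L(k)] never cuts a run of equal parts, [p] is
    the number of odd positions among [1, ..., L(k)], that is, [L(k) / 2] rounded
    up ([odd_shifted_row]).

    Assertions (1) and (2a) are read off from this. In (2) the parity of
    [k - 1] differs from that of [l], so that [L(k - 1)] is odd like [L(k)].
    Since there are no gaps, [lambda_{L(k)} = k], a part of the parity of [l] in
    an odd position; its number is therefore odd and (2b) is vacuous. *)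

(** * Rows of a partition *)

Lemma sum_count_mem (s : seq nat) (a b : nat) :
  \sum_(a <= i < b) count_mem i s = count (fun x => a <= x < b) s.
Proof.
elim: s => [|x s IHs] /=; first by rewrite big1.
rewrite big_split /= IHs; congr (_ + _).
have -> : nat_of_bool (a <= x < b) = \sum_(a <= i < b | i == x) 1.
  by rewrite big_nat1_eq; case: ifP.
by rewrite [RHS]big_mkcond; apply: eq_bigr => i _; rewrite eq_sym; case: eqP.
Qed.

Lemma leq_nth_sorted (s : seq nat) (k i : nat) : sorted geq s -> 0 < k ->
  (k <= nth 0 s i) = (i < count (leq k) s).
Proof.
move=> s_sorted k_gt0; elim: s s_sorted i => [|x s IHs] /=.
  by move=> _ i; rewrite nth_nil; lia.
move=> x_path i.
have x_max : all (geq x) s.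
  by rewrite (order_path_min _ x_path) // => a b c /=; lia.
case: (leqP k x) => [kx|xk].
  by case: i => [|i] //=; rewrite IHs ?(path_sorted x_path) // add1n ltnS.
have -> : count (leq k) s = 0.
  apply/eqP; rewrite -leqn0 leqNgt -has_count; apply/hasPn => y ys.
  by have /= := allP x_max y ys; lia.
case: i => [|i] /=; first by lia.
case: (ltnP i (size s)) => [lt_i|ge_i]; last by rewrite nth_default //; lia.
by have /= := allP x_max _ (mem_nth 0 lt_i); lia.
Qed.

Lemma row_len_count (lam : seq nat) (k : nat) : sorted geq lam ->
  row_len lam k = count (leq k) lam.
Proof.
move=> lam_sorted; rewrite /row_len sum_count_mem.
apply: eq_in_count => x x_lam.
suff : x <= max_part lam by rewrite ltnS => ->; rewrite andbT.
case: lam lam_sorted x_lam => [//|y s] /= y_path.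
rewrite inE => /orP [/eqP -> //|xs].
have /allP/(_ x xs) // : all (geq y) s.
by rewrite (order_path_min _ y_path) // => a b c /=; lia.
Qed.

Lemma leq_nth_row (lam : seq nat) (k i : nat) : sorted geq lam -> 0 < k ->
  (k <= nth 0 lam i) = (i < row_len lam k).
Proof. by move=> ? ?; rewrite row_len_count // leq_nth_sorted. Qed.

Lemma row_len_recl (lam : seq nat) (k : nat) : k <= max_part lam ->
  row_len lam k = multiplicity lam k + row_len lam k.+1.
Proof. by move=> k_max; rewrite /row_len big_ltn. Qed.

(** The part following the row is less than [k], hence without gaps the last part
    of the row is at most [k]. *)
Lemma no_gaps_nth_row (lam : seq nat) (k : nat) :
    sorted geq lam -> no_gaps lam -> 0 < k -> 0 < row_len lam k ->
  nth 0 lam (row_len lam k).-1 = k.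
Proof.
move=> lam_sorted gaps k_gt0 L_gt0.
have := gaps (row_len lam k).-1.
have := leq_nth_row _ _ (row_len lam k).-1 lam_sorted k_gt0.
have := leq_nth_row _ _ (row_len lam k) lam_sorted k_gt0.
by rewrite (prednK L_gt0) ltnn leqnn; lia.
Qed.

Lemma nth_sorted_mono (s : seq nat) (i j : nat) : sorted geq s -> i <= j ->
  nth 0 s j <= nth 0 s i.
Proof.
move=> s_sorted ij; case: (posnP (nth 0 s j)) => [-> //|nth_gt0].
rewrite leq_nth_sorted //; apply: (leq_ltn_trans ij).
by rewrite -leq_nth_sorted.
Qed.

(** * The numbers l - k + lambda_k *)

Lemma nth_extended X lam i : nth 0 (extended X lam) i = nth 0 lam i.
Proof.
have nth_rcons0 : nth 0 (rcons lam 0) i = nth 0 lam i.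
  by rewrite nth_rcons; case: ltngtP => // ?; rewrite nth_default //; lia.
by case: X => //=; case: ifP.
Qed.

Lemma row_len_ext_len X lam k : sorted geq lam ->
  row_len lam k <= ext_len X lam.
Proof.
move=> lam_sorted; rewrite row_len_count //.
apply: leq_trans (count_size _ _) _.
by case: X; rewrite /ext_len /=; [|case: ifP => _|]; rewrite ?size_rcons.
Qed.

Lemma shifted_decr X lam j k : sorted geq lam ->
  j < k -> k <= ext_len X lam -> shifted X lam k < shifted X lam j.
Proof.
move=> lam_sorted jk kl; rewrite /shifted !nth_extended.
have := nth_sorted_mono lam j.-1 k.-1 lam_sorted.
by lia.
Qed.

Lemma shifted_inj X lam j k : sorted geq lam ->
    j <= ext_len X lam -> k <= ext_len X lam ->
  (shifted X lam j == shifted X lam k) = (j == k).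
Proof.
move=> lam_sorted jl kl; case: (ltngtP j k) => [jk|kj|->]; last exact: eqxx.
  by have := shifted_decr X _ _ _ lam_sorted jk kl; lia.
by have := shifted_decr X _ _ _ lam_sorted kj jl; lia.
Qed.

Lemma odd_shifted X lam j : j <= ext_len X lam ->
  odd (shifted X lam j) = odd (ext_len X lam) (+) odd j (+) odd (nth 0 lam j.-1).
Proof. by move=> jl; rewrite /shifted nth_extended oddD oddB. Qed.

(** * Contribution of the first parts *)

Definition parity_positions X lam (b : bool) (N : nat) : seq nat :=
  [seq k <- iota 1 N | odd (shifted X lam k) == b].

Lemma mem_parity_positions X lam b N k :
  (k \in parity_positions X lam b N)
  = (odd (shifted X lam k) == b) && (0 < k <= N).
Proof. by rewrite mem_filter mem_iota add1n ltnS. Qed.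

Lemma parity_positions_cat X lam b N l : N <= l ->
  parity_positions X lam b l = parity_positions X lam b N
    ++ [seq k <- iota N.+1 (l - N) | odd (shifted X lam k) == b].
Proof.
by move=> Nl; rewrite /parity_positions -{1}(subnKC Nl) iotaD filter_cat add1n.
Qed.

(** The numbers decrease with the position, so sorting merely reverses them. *)
Lemma halvesE X lam b : sorted geq lam ->
  halves X lam b =
  rev [seq (shifted X lam k)./2 | k <- parity_positions X lam b (ext_len X lam)].
Proof.
move=> lam_sorted.
rewrite /halves filter_map -map_comp -/(parity_positions _ _ _ _).
set s := map _ _.
have geq_s : sorted geq s.
  rewrite /s sorted_map.
  have ltn_pos : sorted ltn (parity_positions X lam b (ext_len X lam)).
    by apply: sorted_filter (iota_ltn_sorted _ _); apply: ltn_trans.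
  have in_range : all (fun k => k <= ext_len X lam)
      (parity_positions X lam b (ext_len X lam)).
    by apply/allP => k; rewrite mem_parity_positions => /andP[_ /andP[]].
  apply: sub_in_sorted in_range ltn_pos => j k _ kl jk.
  have := shifted_decr X lam j k lam_sorted jk kl.
  by rewrite /relpre /=; lia.
apply: (sorted_eq leq_trans anti_leq).
- exact: sort_sorted leq_total _.
- by rewrite rev_sorted.
- by rewrite perm_sort perm_sym perm_rev.
Qed.

Lemma nentriesE X lam b : sorted geq lam ->
  nentries X lam b = size (parity_positions X lam b (ext_len X lam)).
Proof. by move=> ?; rewrite /nentries halvesE // size_rev size_map. Qed.

(** By strict monotonicity the entry of number [i] in a row comes from a single
    part: the one in the [i]-th position from the end, among the positions whose
    number has the parity of that row. *)
Lemma correspondsE X lam b i k : sorted geq lam ->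
    0 < i <= nentries X lam b -> k <= ext_len X lam ->
  corresponds X lam b i k =
  (k == nth 0 (parity_positions X lam b (ext_len X lam)) (nentries X lam b - i)).
Proof.
move=> lam_sorted; rewrite nentriesE // => /andP[i_gt0 i_le] kl.
set K := parity_positions _ _ _ _ in i_le *.
have lt_K : size K - i < size K by lia.
have := mem_nth 0 lt_K; rewrite mem_parity_positions.
move=> /andP[/eqP parity /andP[_ jl]].
rewrite /corresponds /nth_half halvesE // -/K nth_rev size_map; last by lia.
rewrite (prednK i_gt0) (nth_map 0) // -{1}parity addnC odd_double_half.
exact: shifted_inj.
Qed.

(** The parity class of the first [N] positions is a prefix of that of all
    positions; sorting turns it into a suffix of the row of the symbol. *)
Lemma keptE X lam N b i : sorted geq lam -> N <= ext_len X lam ->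
    0 < i <= nentries X lam b ->
  kept X lam (fun j => 1 <= j <= N) b i
  = last_positions (nentries X lam b) (size (parity_positions X lam b N)) i.
Proof.
move=> lam_sorted Nl i_le.
set K := parity_positions X lam b (ext_len X lam).
set j := nth 0 K (nentries X lam b - i).
have lt_K : nentries X lam b - i < size K by rewrite -nentriesE //; lia.
have j_K : j \in K by rewrite mem_nth.
have -> : kept X lam (fun j => 1 <= j <= N) b i = (j <= N).
  move: (j_K); rewrite mem_parity_positions => /andP[_ /andP[j_gt0 jl]].
  apply/hasP/idP => [[k]|jN].
    rewrite mem_iota => kl /andP[/andP[_ kN]].
    by rewrite correspondsE ?(leq_trans kN) // -/K -/j => /eqP <-.
  exists j; first by rewrite mem_iota; lia.
  by rewrite correspondsE // j_gt0 jN -/K -/j eqxx.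
have -> : (j <= N)
    = (nentries X lam b - i < size (parity_positions X lam b N)).
  move: lt_K; rewrite /j /K (parity_positions_cat _ _ _ _ _ Nl) nth_cat size_cat.
  set p := size (parity_positions X lam b N).
  case: (ltnP (nentries X lam b - i) p) => [lt_p _|ge_p lt_K].
    have := mem_nth 0 lt_p; rewrite mem_parity_positions.
    by case/andP=> _ /andP[_ ->].
  set s := filter _ _ in lt_K *.
  have lt_s : nentries X lam b - i - p < size s by lia.
  have := mem_nth 0 lt_s; rewrite mem_filter mem_iota => /andP[_ /andP[N_lt _]].
  by rewrite leqNgt N_lt.
by rewrite /last_positions; lia.
Qed.

Lemma initial_parts_contribution X lam N : sorted geq lam ->
    N <= ext_len X lam ->
  contribution_consists_of X lam (fun j => 1 <= j <= N)
    (size (parity_positions X lam true N))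
    (size (parity_positions X lam false N)).
Proof.
move=> lam_sorted Nl.
have size_le b : size (parity_positions X lam b N) <= nentries X lam b.
  by rewrite nentriesE // (parity_positions_cat _ _ _ _ _ Nl) size_cat leq_addr.
split=> [|i i_le|i i_le|]; try exact: keptE.
  by rewrite !size_le.
by congr pair; apply/eq_in_map => i; rewrite mem_iota add1n ltnS => i_le;
  rewrite keptE.
Qed.

(** * Parities in the three theories *)

Lemma odd_sumn (s : seq nat) : odd (sumn s) = odd (count odd s).
Proof. by elim: s => //= x s IHs; rewrite !oddD IHs oddb. Qed.

Lemma even_count (T : eqType) (a : pred T) (s : seq T) :
  (forall x, a x -> ~~ odd (count_mem x s)) -> ~~ odd (count a s).
Proof.
move=> even_mult; rewrite -sum1_count -big_undup_iterop_count.
apply: (big_ind (fun n => ~~ odd n)) => // [m n|x /even_mult].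
  by rewrite oddD => /negbTE -> /negbTE ->.
by rewrite Monoid.iteropE iter_addn_0 mul1n.
Qed.

Lemma odd_size_even_mult (s : seq nat) :
    (forall i, ~~ odd i -> ~~ odd (multiplicity s i)) ->
  odd (size s) = odd (sumn s).
Proof.
move=> /(@even_count _ (predC odd)) /negbTE even_evens.
by rewrite odd_sumn -(count_predC odd s) oddD even_evens addbF.
Qed.

Lemma odd_ext_len X n lam : theory_partition X n lam ->
  odd (ext_len X lam) = if X is TypeC then false else true.
Proof.
case: X => -[_ [sum_lam mult]]; rewrite /ext_len /=.
- by rewrite odd_size_even_mult // sum_lam /= odd_double.
- by case: ifP => // odd_lam; rewrite size_rcons /= odd_lam.
- by rewrite size_rcons /= odd_size_even_mult // sum_lam odd_double.
Qed.

(** The common form of the parity conditions defining the three theories. *)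
Lemma even_multiplicity X n lam i : theory_partition X n lam ->
  odd i != odd (ext_len X lam) -> ~~ odd (multiplicity lam i).
Proof.
move=> Hlam; rewrite (odd_ext_len _ _ _ Hlam).
by case: X Hlam => -[_ [_ mult]] odd_i; apply: mult; case: odd odd_i.
Qed.

Lemma row_pair_parity X n lam k k' : theory_partition X n lam ->
  row_pair X lam k k' -> odd k != odd (ext_len X lam).
Proof.
move=> Hlam [_ _ _]; rewrite (odd_ext_len _ _ _ Hlam).
by case: X Hlam => _; case: odd.
Qed.

(** * Odd numbers among the parts of the first rows *)

Lemma count_odd_iota a n : ~~ odd a -> count odd (iota a.+1 n) = uphalf n.
Proof.
elim/ltn_ind: n a => -[|[|n]] IHn a even_a //=.
  by rewrite even_a.
by rewrite IHn ?(negbTE even_a) //= negbK.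
Qed.

Lemma count_odd_even_run a n : ~~ odd n ->
  count (predC odd) (iota a n) = count odd (iota a n).
Proof.
elim/ltn_ind: n a => -[|[|n]] IHn a //=; rewrite negbK => even_n.
by rewrite IHn //; case: odd.
Qed.

(** Parts of the parity of [l] have numbers of the parity of their positions;
    the other parts reverse the parity, but on a run of even length this does
    not change the number of odd values. *)
Lemma count_odd_row X n lam k : theory_partition X n lam -> 0 < k ->
  count (fun j => odd (shifted X lam j)) (iota 1 (row_len lam k))
  = count odd (iota 1 (row_len lam k)).
Proof.
move=> Hlam; have [[lam_sorted _] _] := Hlam.
have [d] := ubnP ((max_part lam).+1 - k); elim: d k => // d IHd k d_ge k_gt0.
case: (leqP k (max_part lam)) => [k_max|k_max]; last by rewrite /row_len big_geq.
have Lk := row_len_recl _ _ k_max.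
have L_le := row_len_ext_len X lam k lam_sorted.
rewrite Lk addnC iotaD !count_cat IHd //; last by lia.
congr (_ + _); rewrite add1n.
set run := iota _ _.
have odd_run j : j \in run ->
    odd (shifted X lam j) = odd j (+) (odd k != odd (ext_len X lam)).
  rewrite mem_iota => j_run.
  have jk : nth 0 lam j.-1 = k.
    have := leq_nth_row _ _ j.-1 lam_sorted k_gt0.
    have := leq_nth_row _ k.+1 j.-1 lam_sorted isT.
    by lia.
  rewrite odd_shifted; last by lia.
  by rewrite jk; do 3!case: odd.
rewrite (eq_in_count odd_run).
case: eqP => [_|/eqP/(even_multiplicity _ _ _ _ Hlam)].
  by apply: eq_count => j /=; rewrite addbF.
move/(count_odd_even_run (row_len lam k.+1).+1) <-.
by apply: eq_count => j /=; rewrite addbT.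
Qed.

Lemma odd_shifted_row X n lam k : theory_partition X n lam -> 0 < k ->
  size (parity_positions X lam true (row_len lam k)) = uphalf (row_len lam k).
Proof.
move=> Hlam k_gt0; rewrite size_filter -(count_odd_iota 0) //.
rewrite -(count_odd_row _ _ _ _ Hlam) //.
by apply: eq_count => j; rewrite eqb_id.
Qed.

Lemma even_shifted_row X n lam k : theory_partition X n lam -> 0 < k ->
  size (parity_positions X lam false (row_len lam k)) = (row_len lam k)./2.
Proof.
move=> Hlam k_gt0.
have := count_predC (fun j => odd (shifted X lam j)) (iota 1 (row_len lam k)).
rewrite (count_odd_row _ _ _ _ Hlam) // (count_odd_iota 0) // size_iota.
have -> : count (predC (fun j => odd (shifted X lam j))) (iota 1 (row_len lam k))
    = size (parity_positions X lam false (row_len lam k)).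
  by rewrite size_filter; apply: eq_count => j /=; rewrite eqbF_neg.
by lia.
Qed.

Lemma row_contribution X n lam k : theory_partition X n lam -> 0 < k ->
  contribution_consists_of X lam (parts_from lam k)
    (uphalf (row_len lam k)) (row_len lam k)./2.
Proof.
move=> Hlam k_gt0; have [[lam_sorted _] _] := Hlam.
rewrite -(odd_shifted_row _ _ _ _ Hlam k_gt0).
rewrite -(even_shifted_row _ _ _ _ Hlam k_gt0).
exact: initial_parts_contribution (row_len_ext_len _ _ _ lam_sorted).
Qed.

Theorem proposition4 (X : theory) (n : nat) (lam : seq nat)
    (Hlam : theory_partition X n lam) (Hrigid : rigid X lam) :
  let l := ext_len X lam in
  let L := row_len lam in
  (* (1) *)
  (forall k, row_pair X lam k k.+1 -> ~~ odd (L k) ->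
     contribution_consists_of X lam (parts_from lam k) (L k)./2 (L k)./2)
  /\
  (* (2) *)
  (forall k, row_pair X lam k.-1 k -> odd (L k) ->
     (* (2a) *)
     (odd (l - L k + nth 0 lam (L k).-1) ->
        contribution_consists_of X lam (parts_from lam k)
          ((L k - 1)./2 + 1) (L k - 1)./2 /\
        contribution_consists_of X lam (parts_from lam k.-1)
          ((L k.-1 - 1)./2 + 1) (L k.-1 - 1)./2)
     /\
     (* (2b) *)
     (~~ odd (l - L k + nth 0 lam (L k).-1) ->
        contribution_consists_of X lam (parts_from lam k)
          (L k - 1)./2 ((L k - 1)./2 + 1) /\
        contribution_consists_of X lam (parts_from lam k.-1)
          (L k.-1 - 1)./2 ((L k.-1 - 1)./2 + 1))).
Proof.
move=> l L; have [[lam_sorted _] _] := Hlam.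
split=> [k [k_gt0 _ _ _] even_L|k pair_k odd_L].
  have := row_contribution _ _ _ _ Hlam k_gt0.
  by rewrite uphalf_half -/(L k) (negbTE even_L).
have parity := row_pair_parity _ _ _ _ _ Hlam pair_k.
have [k1_gt0 k_eq k_max _] := pair_k.
have k_gt0 : 0 < k by lia.
have odd_contribution j : 0 < j -> odd (L j) ->
    contribution_consists_of X lam (parts_from lam j)
      ((L j - 1)./2 + 1) (L j - 1)./2.
  move=> j_gt0 odd_Lj; have := row_contribution _ _ _ _ Hlam j_gt0.
  rewrite -/(L j).
  have -> : uphalf (L j) = (L j - 1)./2 + 1 by lia.
  by have -> : (L j)./2 = (L j - 1)./2 by lia.
split=> [_|even_k].
  split; apply: odd_contribution => //.
  rewrite /L row_len_recl -?k_eq; last by lia.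
  by rewrite oddD (negbTE (even_multiplicity _ _ _ _ Hlam parity)).
have [gaps _] := Hrigid.
have Lk : nth 0 lam (L k).-1 = k.
  by apply: no_gaps_nth_row => //; apply: odd_gt0.
have := row_len_ext_len X lam k lam_sorted; rewrite -/(L k) -/l => L_le.
(* [k] has the parity of [l] and [L k] is odd, so the last part equal to [k]
   has an odd number, contrary to [even_k]. *)
move: even_k; rewrite Lk oddD oddB // odd_L.
by move: parity; rewrite k_eq /= -/l; do 2!case: odd.
Qed.
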